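(* For all $r\in\mathbb{N}\cup\{0\}$ and $s,t\in\mathbb{N}$, there exists $\Omega=\Omega(r,s,t)\in\mathbb{N}$ with the following property. Let $G$ be a graph and let $(W,\Lambda)$ be an $(r,\Omega)$-web in $G$. Then one of the following holds. (a) $G$ contains an induced subgraph isomorphic to $K_t$ or $K_{t,t}$. (b) There exists $S\subseteq W$ with $|S|=s$ such that: - $S$ is a stable set in $G$; - for all three (distinct) vertices $x,y,z\in S$, $x$ is anticomplete to $\Lambda^*_{y,z}$; and - for all distinct $2$-subsets $\{x,y\},\{x',y'\}$ of $S$, $\Lambda^*_{x,y}$ and $\Lambda^*_{x',y'}$ are anticomplete in $G$.
   Context: $\mathbb{N}$ is the set of all positive integers. Graphs have finite vertex sets, no loops and no parallel edges. For a set $X$ and an integer $q\ge 0$, $2^X$ is the set of all subsets of $X$ and $\binom{X}{q}$ is the set of all $q$-element subsets ($q$-subsets) of $X$. Induced subgraphs and their vertex sets are referred to interchangeably. A path in $G$ is an induced subgraph of $G$ which is a path; its length is its number of edges. The ends of a path $L$ in $G$ are its vertices of degree less than two in $L$, and the interior $L^*$ of $L$ is the set of all other vertices of $L$ (so a path of length at most one has empty interior). A stable set in $G$ is a set of pairwise non-adjacent vertices. Two subsets $X,Y\subseteq V(G)$ are anticomplete (in $G$) if there is no edge of $G$ with an end in $X$ and an end in $Y$; a vertex $x$ is anticomplete to $Y$ if $\{x\}$ and $Y$ are anticomplete. For $w\in\mathbb{N}$, a $w$-web in $G$ is a pair $(W,\Lambda)$ where: (W1) $W$ is a $w$-subset of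 $V(G)$; (W2) $\Lambda:\binom{W}{2}\to 2^{V(G)}$ is a map such that $\Lambda(\{x,y\})=\Lambda_{x,y}$ is a path in $G$ with ends $x,y$ for every $2$-subset $\{x,y\}$ of $W$; and (W3) $\Lambda_{x,y}\cap\Lambda_{x',y'}=\{x,y\}\cap\{x',y'\}$ for all distinct $2$-subsets $\{x,y\},\{x',y'\}$ of $W$. For $r\in\mathbb{N}\cup\{0\}$, an $(r,w)$-web in $G$ is a $w$-web $(W,\Lambda)$ in $G$ such that for every $2$-subset $\{x,y\}$ of $W$, the path $\Lambda_{x,y}$ has length at most $r+1$. $\Lambda^*_{x,y}$ denotes the interior of the path $\Lambda_{x,y}$. *)

(* Defs.v *)
From mathcomp Require Import all_boot.

Set Implicit Arguments.
Unset Strict Implicit.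
Unset Printing Implicit Defensive.

Record sgraph := SGraph {
  vertex :> finType;
  adj : rel vertex;
  adj_sym : symmetric adj;
  adj_irr : irreflexive adj }.

Arguments adj {s}.

Definition path_adj n : rel 'I_n :=
  fun i j => (i.+1 == j :> nat) || (j.+1 == i :> nat).

Lemma path_adj_sym n : symmetric (@path_adj n).
Proof. by move=> i j; rewrite /path_adj orbC. Qed.

Lemma path_adj_irr n : irreflexive (@path_adj n).
Proof. by move=> i; rewrite /path_adj orbb eqn_leq ltnn. Qed.

Definition path_graph n : sgraph :=
  SGraph (@path_adj_sym n) (@path_adj_irr n).

Definition complete_adj n : rel 'I_n := fun i j => i != j.

Lemma complete_adj_sym n : symmetric (@complete_adj n).
Proof. by move=> i j; rewrite /complete_adj eq_sym. Qed.

Lemma complete_adj_irr n : irreflexive (@complete_adj n).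
Proof. by move=> i; rewrite /complete_adj eqxx. Qed.

Definition complete_graph n : sgraph :=
  SGraph (@complete_adj_sym n) (@complete_adj_irr n).

Definition biclique_adj m n : rel ('I_m + 'I_n)%type :=
  fun u v => match u, v with
             | inl _, inr _ | inr _, inl _ => true
             | _, _ => false
             end.

Lemma biclique_adj_sym m n : symmetric (@biclique_adj m n).
Proof. by case=> i [] j. Qed.

Lemma biclique_adj_irr m n : irreflexive (@biclique_adj m n).
Proof. by case. Qed.

Definition biclique_graph m n : sgraph :=
  SGraph (@biclique_adj_sym m n) (@biclique_adj_irr m n).

Section Graph.

Variable G : sgraph.
Implicit Types (A L S W X Y : {set G}) (H : sgraph).

(* The subgraph of G induced on A is isomorphic to H. *)
Definition induces A H : Prop :=
  exists f : H -> G,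
    [/\ injective f, f @: [set: H] = A & forall u v, adj (f u) (f v) = adj u v].

Definition contains_induced H : Prop := exists A, induces A H.

(* Paths are nonempty. *)
Definition is_path L : Prop := exists n, induces L (path_graph n.+1).

Definition degree_in L (x : G) : nat := #|[set y in L | adj x y]|.

Definition path_ends L : {set G} := [set x in L | degree_in L x < 2].

Definition path_interior L : {set G} := L :\: path_ends L.

Definition edges_in L : {set {set G}} :=
  [set [set p.1; p.2] | p in [set p in setX L L | adj p.1 p.2]].

Definition path_length L : nat := #|edges_in L|.

Definition stable S : Prop := {in S &, forall x y, ~~ adj x y}.

Definition anticomplete X Y : Prop :=
  forall x y, x \in X -> y \in Y -> ~~ adj x y.

Definition subsets_of_size X (q : nat) : {set {set G}} :=
  [set A : {set G} | (A \subset X) && (#|A| == q)].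

(* Lam stands for a map defined on the 2-subsets of W: its values elsewhere
   are never constrained. *)
Definition web (w : nat) W (Lam : {set G} -> {set G}) : Prop :=
  [/\ #|W| = w,
      forall A, A \in subsets_of_size W 2 ->
        is_path (Lam A) /\ path_ends (Lam A) = A
    & forall A B, A \in subsets_of_size W 2 -> B \in subsets_of_size W 2 ->
        A != B -> Lam A :&: Lam B = A :&: B].

Definition rweb (r w : nat) W (Lam : {set G} -> {set G}) : Prop :=
  web w W Lam /\
  forall A, A \in subsets_of_size W 2 -> path_length (Lam A) <= r.+1.

End Graph.

(* Main.v *)
Require Import Defs.
From mathcomp Require Import all_boot.
From mathcomp Require Import zify.

(** Fix a linear order on [W] and name every vertex of the web by a pair of
    vertices of [W] and a number: the pair [x, x] names [x], and for [x != y]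
    the pair together with [a <= r] names the [a]-th vertex in the interior of
    the path joining [x] to [y], which has at most [r] vertices.  Whether the
    vertices named by [(x, y, a)] and [(z, u, b)] are adjacent is thus one of
    finitely many properties of the quadruple [x, y, z, u].  If [W] is large,
    the theorem of Ramsey for 4-subsets yields a long subsequence of [W] on
    which these properties depend only on the order type of the quadruple
    ([order_invariant_subseq]).  Let [S] consist of every [t]-th entry of that
    subsequence.

    Suppose that two distinct pairs from [S], neither contained in the other,
    name adjacent vertices.  Keep the elements common to both pairs fixed, and
    replace every other element at position [x * t] by the one at position
    [x * t + m], for [m < t].  The room left between consecutive elements of
    [S] means that this respects the order, even when the two pairs move by
    different amounts, so [t] copies of the first vertex are completely joined
    to [t] copies of the second.  The copies of one vertex are distinct, since
    distinct pairs name distinct vertices ([spot_inj]).  Order invariance,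
    applied once more, makes the copies of one vertex pairwise adjacent or
    pairwise non-adjacent.  Hence [G] contains an induced [K_t] or [K_{t,t}]
    ([adjacency_blows_up]).  If no two such pairs exist, then [S] satisfies all
    three conditions of the other alternative, since each of them forbids
    adjacencies of this kind. *)

Set Implicit Arguments.
Unset Strict Implicit.
Unset Printing Implicit Defensive.

(** * Ramsey's theorem for sequences *)

(** The length [d.+1] is reduced to [d] by the following strengthening, proved
    by induction on the sum of the targets: for any targets [n k], some colour
    [k] has a homogeneous subsequence of length [n k].  Put the first entry [x]
    aside and make the rest homogeneous, of colour [k0] say, for the colouring
    of [u] by [c (x :: u)]; lower the target of [k0] by one and recurse.  If
    the recursion returns [k0] then [x] can be added back. *)
Lemma ramsey_subseq (C : finType) d N :
  exists M, forall (T : eqType) (c : seq T -> C) (s : seq T), M <= size s ->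
  exists k s', [/\ subseq s' s, size s' = N &
    forall u, subseq u s' -> size u = d -> c u = k].
Proof.
elim: d N => [|d IHd] N.
  exists N => T c s le_s; exists (c [::]), (take N s).
  split; [exact: take_subseq | exact: size_takel | by move=> u _ /size0nil->].
suff tally K : exists M, forall (T : eqType) (c : seq T -> C) (n : C -> nat) s,
    \sum_k n k <= K -> M <= size s ->
    exists k s', [/\ subseq s' s, size s' = n k &
      forall u, subseq u s' -> size u = d.+1 -> c u = k].
  have [M Mgood] := tally (\sum_(k : C) N).
  by exists M => T c s le_s; apply: (Mgood T c (fun=> N)).
have vacuous (T : eqType) (c : seq T -> C) (k : C) (n : C -> nat) s : n k = 0 ->
    exists k s', [/\ subseq s' s, size s' = n k &
      forall u, subseq u s' -> size u = d.+1 -> c u = k].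
  move=> nk0; exists k, [::]; split=> //; first exact: sub0seq.
  by move=> u; rewrite subseq0 => /eqP->.
elim: K => [|K [M IHK]].
  exists 0 => T c n s; rewrite leqn0 sum_nat_eq0 => /forallP/(_ (c [::]))/eqP.
  by move=> nk0 _; apply: vacuous nk0.
have [M' M'good] := IHd M.
exists M'.+1 => T c n [//|x s] le_n le_s.
have [k0 [s1 [s1s size_s1 c_s1]]] := M'good T (c \o cons x) s le_s.
have [nk0|nk0] := posnP (n k0); first exact: vacuous nk0.
pose n' k := n k - (k == k0).
have le_n' : \sum_k n' k <= K.
  rewrite (bigD1 k0) //= /n' eqxx; move: le_n; rewrite (bigD1 k0) //=.
  under [X in _ -> _ + X <= _]eq_bigr => k /negPf-> do rewrite subn0.
  by lia.
have [k [s' [s's1 size_s' c_s']]] := IHK T c n' s1 le_n' (eq_leq (esym size_s1)).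
have s's := subseq_trans s's1 s1s.
have [kk0|k_neq] := eqVneq k k0; last first.
  exists k, s'; split=> //; first exact: subseq_trans (subseq_cons s x).
  by rewrite size_s' /n' (negPf k_neq) subn0.
exists k, (x :: s'); split=> /=; first by rewrite eqxx.
  by rewrite size_s' /n' kk0 eqxx subn1 prednK.
case=> [//|y u] /=; case: eqP => [->|_] us'; last exact: (c_s' (y :: u)).
by case=> size_u; rewrite kk0; apply: c_s1; first exact: subseq_trans s's1.
Qed.

(** * Order invariance *)

Definition increasing_into N (f : nat -> nat) B :=
  {homo f : x y / x < y} /\ forall x, x < B -> f x < N.

(** Tuples with repetitions are read off from strictly increasing ones; the
    padding makes all of the latter equally long, as homogeneity requires. *)
Lemma extend_to_increasing d B (p : seq nat) :
  size p <= d -> d <= B -> all (gtn B) p ->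
  exists u, [/\ sorted ltn u, size u = d, all (gtn B) u & {subset p <= u}].
Proof.
move=> le_p le_d ltp.
pose e := [seq x <- iota 0 B | x \notin p].
pose q := undup p ++ take (d - size (undup p)) e.
have size_u : size (undup p) <= size p := size_undup p.
have size_e : d - size (undup p) <= size e.
  have : size [seq x <- iota 0 B | x \in p] + size e = B.
    by rewrite !size_filter count_predC size_iota.
  have : size [seq x <- iota 0 B | x \in p] <= size (undup p).
    apply: uniq_leq_size => [|x]; first exact/filter_uniq/iota_uniq.
    by rewrite mem_filter mem_undup => /andP[].
  by lia.
exists (sort leq q); split.
- rewrite ltn_sorted_uniq_leq sort_uniq (sort_sorted leq_total) andbT.
  rewrite cat_uniq undup_uniq take_uniq ?filter_uniq ?iota_uniq // andbT.
  apply/hasPn=> x /mem_take; rewrite mem_filter => /andP[xp _].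
  by rewrite /= mem_undup.
- by rewrite size_sort size_cat size_takel // subnKC // (leq_trans size_u).
- rewrite all_sort all_cat; apply/andP; split; apply/allP=> x.
    by rewrite mem_undup => /(allP ltp).
  by move/mem_take; rewrite mem_filter mem_iota => /and3P[].
- by move=> x xp; rewrite mem_sort mem_cat mem_undup xp.
Qed.

Lemma subseq_nth_map (T : eqType) (x0 : T) (s : seq T) (u : seq nat) :
  sorted ltn u -> all (gtn (size s)) u -> subseq (map (nth x0 s) u) s.
Proof.
move=> u_inc u_lt; rewrite -[X in subseq _ X](mkseq_nth x0); apply: map_subseq.
suff -> : u = [seq x <- iota 0 (size s) | x \in u] by apply: filter_subseq.
apply: (irr_sorted_eq ltn_trans ltnn u_inc).
  exact/(sorted_filter ltn_trans)/iota_ltn_sorted.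
move=> x; rewrite mem_filter mem_iota /=.
by case: (boolP (x \in u)) => // /(allP u_lt).
Qed.

(** Ramsey's theorem in the form used here: finitely many properties of
    [d.+1]-tuples depend only on the order type of the tuple.  Having the same
    order type is expressed as being images [f p] and [g p] of one pattern [p]
    under strictly increasing maps, so that ties and permutations in [p] need
    no separate treatment. *)
Lemma order_invariant_subseq (I : finType) d N :
  exists M, forall (T : eqType) (x0 : T) (P : I -> seq T -> bool) (s : seq T),
  M <= size s ->
  exists s', [/\ subseq s' s, size s' = N &
    forall i B f g p, d < B -> size p = d.+1 -> all (gtn B) p ->
      increasing_into N f B -> increasing_into N g B ->
      P i [seq nth x0 s' (f x) | x <- p] = P i [seq nth x0 s' (g x) | x <- p]].
Proof.
have [M Mgood] :=
  ramsey_subseq {ffun I * (d.+1).-tuple 'I_d.+1 -> bool} d.+1 N.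
exists M => T x0 P s le_s.
(* The colour of [u] records every property of every tuple with entries in [u]. *)
pose c (u : seq T) := [ffun z : I * (d.+1).-tuple 'I_d.+1 =>
  P z.1 [seq nth x0 u (k : 'I__) | k <- z.2]].
have [k [s' [s's size_s' c_s']]] := Mgood T c s le_s.
exists s'; split=> // i B f g p ltdB size_p p_lt f_inc g_inc.
have [u [u_inc size_u u_lt pu]] := extend_to_increasing (eq_leq size_p) ltdB p_lt.
have p_ok : size (map (fun x => inord (index x u) : 'I_d.+1) p) == d.+1.
  by rewrite size_map size_p.
suff colour h : increasing_into N h B ->
    P i [seq nth x0 s' (h x) | x <- p] = k (i, Tuple p_ok).
  by rewrite !colour.
case=> h_inc h_lt; rewrite -(c_s' (map (nth x0 s') (map h u))).
- rewrite ffunE /= -map_comp; congr (P i _); apply/eq_in_map => x /pu xu /=.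
  have lt_xu : index x u < size u by rewrite index_mem.
  rewrite inordK -?size_u // (nth_map 0) ?size_map // (nth_map 0) //.
  by rewrite nth_index.
- apply: subseq_nth_map; first exact: homo_sorted u_inc.
  by rewrite size_s' all_map; apply/allP=> x /(allP u_lt) /h_lt.
- by rewrite !size_map.
Qed.

(** * Cliques and bicliques from homogeneous families *)

Section Graph.
Variable G : sgraph.

Lemma contains_induced_embedding (H : sgraph) (f : H -> G) :
  injective f -> (forall u v, adj (f u) (f v) = adj u v) -> contains_induced G H.
Proof. by move=> f_inj f_adj; exists (f @: [set: H]), f. Qed.

Lemma homogeneous_adj t (x : 'I_t -> G) :
  (forall m m' n n' : 'I_t, m < m' -> n < n' ->
     adj (x m) (x m') = adj (x n) (x n')) ->
  (forall m n, adj (x m) (x n) = (m != n)) \/ (forall m n, ~~ adj (x m) (x n)).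
Proof.
move=> hom.
case: (boolP [exists m : 'I_t, exists n : 'I_t, (m < n) && adj (x m) (x n)]).
  case/existsP=> m0 /existsP[n0 /andP[lt0 adj0]]; left=> m n.
  case: (ltngtP m n) => [lt|lt|/ord_inj->]; last by rewrite adj_irr eqxx.
    by rewrite (hom _ _ _ _ lt lt0) adj0 -(inj_eq val_inj) ltn_eqF.
  by rewrite adj_sym (hom _ _ _ _ lt lt0) adj0 -(inj_eq val_inj) gtn_eqF.
move/existsPn=> noadj; right=> m n.
have lt_noadj (i j : 'I_t) : i < j -> ~~ adj (x i) (x j).
  by move=> lt; have /existsPn/(_ j) := noadj i; rewrite lt.
case: (ltngtP m n) => [lt|lt|/ord_inj->]; last by rewrite adj_irr.
  exact: lt_noadj.
by rewrite adj_sym lt_noadj.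
Qed.

Lemma clique_or_biclique t (x y : 'I_t -> G) :
  injective x -> injective y -> (forall m n, adj (x m) (y n)) ->
  (forall m m' n n' : 'I_t, m < m' -> n < n' ->
     adj (x m) (x m') = adj (x n) (x n')) ->
  (forall m m' n n' : 'I_t, m < m' -> n < n' ->
     adj (y m) (y m') = adj (y n) (y n')) ->
  contains_induced G (complete_graph t) \/
  contains_induced G (biclique_graph t t).
Proof.
move=> x_inj y_inj xy /homogeneous_adj[xK|x0].
  by left; apply: (@contains_induced_embedding (complete_graph t) x).
move=> /homogeneous_adj[yK|y0].
  by left; apply: (@contains_induced_embedding (complete_graph t) y).
right; pose f (u : 'I_t + 'I_t) := match u with inl m => x m | inr n => y n end.
apply: (@contains_induced_embedding (biclique_graph t t) f) => [u v|u v].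
  have xy_neq m n : x m <> y n by move=> e; have := xy m n; rewrite e adj_irr.
  case: u v => [m|m] [n|n] /=; first by move/x_inj->.
  - by move/xy_neq.
  - by move/esym/xy_neq.
  - by move/y_inj->.
case: u v => [m|m] [n|n] /=; first exact: (negPf (x0 m n)).
- exact: xy.
- by rewrite adj_sym xy.
- exact: (negPf (y0 m n)).
Qed.

(** * Vertices named by pairs in a web *)

Lemma path_card (L : {set G}) : is_path L -> #|L| <= (path_length L).+1.
Proof.
case=> n [f [f_inj fL f_adj]].
have -> : #|L| = n.+1 by rewrite -fL card_imset // cardsT card_ord.
(* The pairs of consecutive vertices are distinct edges. *)
rewrite ltnS /path_length.
pose lo (i : 'I_n) : 'I_n.+1 := widen_ord (leqnSn n) i.
pose hi (i : 'I_n) : 'I_n.+1 := lift ord0 i.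
pose e (i : 'I_n) : {set G} := [set f (lo i); f (hi i)].
have hiE i : hi i = i.+1 :> nat by rewrite /hi lift0.
have e_inj : injective e.
  move=> i j eij; apply: val_inj => /=.
  have: f (lo i) \in e j by rewrite -eij set21.
  have: f (hi i) \in e j by rewrite -eij set22.
  rewrite !inE !(inj_eq f_inj) -!(inj_eq val_inj) [val (hi i)]hiE [val (hi j)]hiE /=.
  by lia.
rewrite -[X in X <= _]card_ord -(card_imset _ e_inj).
apply/subset_leq_card/subsetP=> _ /imsetP[i _ ->]; apply/imsetP.
exists (f (lo i), f (hi i)) => //.
rewrite inE /= f_adj in_setX -fL !imset_f ?inE //=.
by rewrite /path_adj hiE eqxx.
Qed.

Lemma path_interior_card (L : {set G}) :
  is_path L -> #|path_ends L| = 2 -> (#|path_interior L|).+1 <= path_length L.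
Proof.
move=> /path_card leL ends2.
have : #|L| = #|L :&: path_ends L| + #|path_interior L| by rewrite cardsID.
have /setIidPr-> : path_ends L \subset L by apply/subsetP=> x; rewrite inE => /andP[].
by rewrite ends2; lia.
Qed.


(** The vertex named by [x, y] and [a].  Letting [x, x] name [x] itself allows
    the elements of [W] and the interior vertices to be treated alike. *)
Definition spot (Lam : {set G} -> {set G}) a x y : option G :=
  if x == y then Some x else onth (enum (path_interior (Lam [set x; y]))) a.

(** Adjacency of named vertices as a property of sequences, the form in which
    order invariance applies; it fails if one of the names is void. *)
Definition linked Lam a b (p : seq G) : bool :=
  if p is [:: x; y; z; u] then
    if (spot Lam a x y, spot Lam b z u) is (Some v, Some v') then adj v v'
    else false
  else false.

Lemma linked_spots Lam a b x y z u x0 :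
  linked Lam a b [:: x; y; z; u] ->
  [/\ spot Lam a x y = Some (odflt x0 (spot Lam a x y)),
      spot Lam b z u = Some (odflt x0 (spot Lam b z u)) &
      adj (odflt x0 (spot Lam a x y)) (odflt x0 (spot Lam b z u))].
Proof. by rewrite /=; case: spot => // v; case: spot. Qed.

Section Web.
Variables (n : nat) (W : {set G}) (Lam : {set G} -> {set G}).
Hypothesis webW : web n W Lam.

Lemma pair_in_web x y :
  x \in W -> y \in W -> x != y -> [set x; y] \in subsets_of_size W 2.
Proof.
move=> xW yW xy; rewrite inE cards2 xy eqxx andbT.
by apply/subsetP=> z; rewrite !inE => /orP[]/eqP->.
Qed.

(** The axioms only compare distinct paths, so an element [x] of [W] inside the
    path of [A] is compared with a path that starts at [x]: its other end is
    taken in [A], and the two paths would meet in [x], which is not in [A]. *)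
Lemma interior_off_web A x :
  A \in subsets_of_size W 2 -> x \in path_interior (Lam A) -> x \notin W.
Proof.
case: webW => _ paths disj A2; have [_ endsA] := paths A A2.
rewrite inE endsA => /andP[xA xL]; apply/negP=> xW.
have: 0 < #|A| by move: A2; rewrite inE => /andP[_ /eqP->].
case/card_gt0P=> y yA.
have yx : y != x by apply: contraNneq xA => <-.
have B2 : [set x; y] \in subsets_of_size W 2.
  apply: pair_in_web => //; last by rewrite eq_sym.
  by move: A2; rewrite inE => /andP[/subsetP->].
have neqAB : A != [set x; y] by apply: contraNneq xA => ->; rewrite set21.
have [_ endsB] := paths _ B2.
have: x \in path_ends (Lam [set x; y]) by rewrite endsB set21.
rewrite inE => /andP[xLB _].
have: x \in Lam A :&: Lam [set x; y] by rewrite inE xL.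
by rewrite disj // inE (negPf xA).
Qed.

Lemma spot_inj a b x y z u v :
  x \in W -> y \in W -> z \in W -> u \in W ->
  spot Lam a x y = Some v -> spot Lam b z u = Some v ->
  [set x; y] = [set z; u].
Proof.
move=> xW yW zW uW; rewrite /spot.
have inner c A : onth (enum (path_interior (Lam A))) c = Some v ->
    v \in path_interior (Lam A).
  by move=> e; rewrite -mem_enum; apply/onthP; exists c.
have [<-|xy] := eqVneq x y; have [<-|zu] := eqVneq z u.
- by move=> [->] [->].
- move=> /= [e] /inner xL; have := interior_off_web (pair_in_web zW uW zu) xL.
  by rewrite -e xW.
- move=> /= /inner vL [e]; have := interior_off_web (pair_in_web xW yW xy) vL.
  by rewrite -e zW.
- move=> /= /inner v1 /inner v2; apply/eqP; apply: contraT => neq.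
  have A2 := pair_in_web xW yW xy; have B2 := pair_in_web zW uW zu.
  case: webW => _ paths disj; have [_ endsA] := paths _ A2.
  move: v1 v2; rewrite !in_setD => /andP[vA vLA] /andP[_ vLB].
  have: v \in Lam [set x; y] :&: Lam [set z; u] by rewrite inE vLA.
  by rewrite disj // in_setI -endsA (negPf vA).
Qed.

(** * Blowing up an adjacency *)

(** The position of the [m]-th copy of the element at position [x * t], where
    [Z] holds the elements that stay in place. *)
Definition stretch t (Z : pred nat) m x := x * t + (if Z x then 0 else m).

Variables (t B : nat) (w : nat -> G).
Hypotheses (t_gt0 : 0 < t) (B_gt3 : 3 < B).
Hypothesis w_in : forall x, x < B * t -> w x \in W.
Hypothesis w_inj : forall x y, x < B * t -> y < B * t -> w x = w y -> x = y.

Definition blowup a (Z : pred nat) i j m : option G :=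
  spot Lam a (w (stretch t Z m i)) (w (stretch t Z m j)).

Lemma stretch_lt Z m x : m < t -> x < B -> stretch t Z m x < B * t.
Proof. by rewrite /stretch; case: (Z x); nia. Qed.

(** An element that moves determines [m], and at least one of [i, j] moves. *)
Lemma blowup_inj a (Z : pred nat) i j m n0 v :
  m < t -> n0 < t -> i < B -> j < B -> ~~ (Z i && Z j) ->
  blowup a Z i j m = Some v -> blowup a Z i j n0 = Some v -> m = n0.
Proof.
move=> lt_m lt_n lt_i lt_j nZ em en.
have eq_sets := spot_inj (w_in (stretch_lt Z lt_m lt_i))
  (w_in (stretch_lt Z lt_m lt_j)) (w_in (stretch_lt Z lt_n lt_i))
  (w_in (stretch_lt Z lt_n lt_j)) em en.
have key x : (x == i) || (x == j) -> ~~ Z x -> m = n0.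
  move=> xij nZx; have lt_x : x < B by case/orP: xij => /eqP->.
  have: w (stretch t Z m x) \in [set w (stretch t Z n0 i); w (stretch t Z n0 j)].
    by rewrite -eq_sets !inE; case/orP: xij => /eqP->; rewrite eqxx ?orbT.
  rewrite !inE => /orP[] /eqP /w_inj; rewrite !stretch_lt // => /(_ isT isT);
    rewrite /stretch (negPf nZx).
  - case: (eqVneq x i) => [<-|xi]; first by rewrite (negPf nZx); lia.
    by case: (Z i); nia.
  - case: (eqVneq x j) => [<-|xi]; first by rewrite (negPf nZx); lia.
    by case: (Z j); nia.
by move: nZ; rewrite negb_and => /orP[]; apply: key; rewrite eqxx ?orbT.
Qed.

Variable c : nat.
Hypothesis invariant : forall (a b : 'I_c) B' f g p,
  3 < B' -> size p = 4 -> all (gtn B') p ->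
  increasing_into (B * t) f B' -> increasing_into (B * t) g B' ->
  linked Lam a b [seq w (f x) | x <- p] = linked Lam a b [seq w (g x) | x <- p].

(** All pairs of copies with [m < m'] are images of a single pattern: position
    [x.*2] stands for the lower copy of [x] and [x.*2.+1] for the upper copy,
    which coincide when [x] stays in place. *)
Lemma blowup_homogeneous (a : 'I_c) Z i j m m' n0 n' :
  i < B -> j < B -> m < m' < t -> n0 < n' < t ->
  linked Lam a a [:: w (stretch t Z m i); w (stretch t Z m j);
                     w (stretch t Z m' i); w (stretch t Z m' j)] =
  linked Lam a a [:: w (stretch t Z n0 i); w (stretch t Z n0 j);
                     w (stretch t Z n' i); w (stretch t Z n' j)].
Proof.
move=> lt_i lt_j lt_m lt_n.
pose chi k k' y := y./2 * t + (if odd y then k' else if Z y./2 then 0 else k).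
pose top x := if Z x then x.*2 else x.*2.+1.
have chi_even k k' x : chi k k' x.*2 = stretch t Z k x.
  by rewrite /chi doubleK odd_double.
have chi_top k k' x : chi k k' (top x) = stretch t Z k' x.
  rewrite /chi /top /stretch; case Zx: (Z x).
    by rewrite doubleK odd_double Zx.
  by rewrite -[x.*2.+1]/(true + x.*2) half_bit_double oddD odd_double.
have top_lt x : x < B -> top x < B.*2 by rewrite /top; case: (Z x); lia.
have chi_inc k k' : k < k' < t -> increasing_into (B * t) (chi k k') B.*2.
  move=> lt_k; split=> [x y xy|x ltx]; rewrite /chi; last first.
    have: x./2 < B by lia.
    by case: (odd x); case: (Z x./2); nia.
  have [e|lt] : x./2 = y./2 \/ x./2 < y./2 by lia.
    have -> : odd y by lia.
    have /negPf-> : ~~ odd x by lia.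
    by rewrite e; case: ifP; lia.
  by case: (odd x); case: (odd y); case: (Z x./2); case: (Z y./2); nia.
pose p := [:: i.*2; j.*2; top i; top j].
have chi_p k k' : [seq w (chi k k' x) | x <- p] =
    [:: w (stretch t Z k i); w (stretch t Z k j);
        w (stretch t Z k' i); w (stretch t Z k' j)].
  by rewrite /= !chi_even !chi_top.
rewrite -!chi_p; apply: (@invariant a a B.*2 (chi m m') (chi n0 n') p) => //; first by lia.
- by rewrite /p /= !top_lt // !ltn_double lt_i lt_j.
- exact: chi_inc.
- exact: chi_inc.
Qed.

(** The hypotheses on [i, j] and [k, l] say that each pair has an element that
    is not in the other one; that element moves while common ones stay. *)
Lemma adjacency_blows_up (a b : 'I_c) i j k l :
  i < B -> j < B -> k < B -> l < B ->
  ~~ ((i \in [:: k; l]) && (j \in [:: k; l])) ->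
  ~~ ((k \in [:: i; j]) && (l \in [:: i; j])) ->
  linked Lam a b [:: w (i * t); w (j * t); w (k * t); w (l * t)] ->
  contains_induced G (complete_graph t) \/
  contains_induced G (biclique_graph t t).
Proof.
move=> lt_i lt_j lt_k lt_l nij nkl adj0.
pose Z x := (x \in [:: i; j]) && (x \in [:: k; l]).
have nZij : ~~ (Z i && Z j).
  by rewrite /Z mem_head [j \in [:: i; j]]inE mem_head orbT.
have nZkl : ~~ (Z k && Z l).
  by rewrite /Z mem_head [l \in [:: k; l]]inE mem_head orbT !andbT.
(* One increasing map moves the first pair by [m] and the second by [n0]. *)
pose psi m n0 x :=
  x * t + (if Z x then 0 else if x \in [:: i; j] then m else n0).
have psi_inc m n0 : m < t -> n0 < t -> increasing_into (B * t) (psi m n0) B.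
  move=> lt_m lt_n; rewrite /psi.
  have step x : (if Z x then 0 else if x \in [:: i; j] then m else n0) < t.
    by case: ifP => // _; case: ifP.
  have le_mul x y : x < y -> x * t + t <= y * t.
    by move=> lt_xy; rewrite addnC -mulSn leq_mul2r lt_xy orbT.
  split=> [x y /le_mul lt_xy|x /le_mul lt_xB].
    by apply: leq_trans (leq_addr _ _); apply: leq_trans lt_xy; rewrite ltn_add2l.
  by apply: leq_trans lt_xB; rewrite ltn_add2l.
have psi_ij m n0 x : x \in [:: i; j] -> psi m n0 x = stretch t Z m x.
  by rewrite /psi /stretch => ->.
have psi_kl m n0 x : x \in [:: k; l] -> psi m n0 x = stretch t Z n0 x.
  by rewrite /psi /stretch /Z => ->; case: (x \in _).
have psi0 x : psi 0 0 x = x * t by rewrite /psi; rewrite !if_same addn0.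
have cross m n0 : m < t -> n0 < t ->
    linked Lam a b [:: w (stretch t Z m i); w (stretch t Z m j);
                       w (stretch t Z n0 k); w (stretch t Z n0 l)].
  move=> lt_m lt_n.
  have := @invariant a b B _ _ [:: i; j; k; l] B_gt3 erefl _
    (psi_inc _ _ lt_m lt_n) (psi_inc _ _ t_gt0 t_gt0).
  rewrite /= lt_i lt_j lt_k lt_l !psi0 => /(_ isT).
  rewrite (psi_ij _ _ i) ?mem_head // (psi_ij _ _ j) ?inE ?eqxx ?orbT //.
  rewrite (psi_kl _ _ k) ?mem_head // (psi_kl _ _ l) ?inE ?eqxx ?orbT //.
  by rewrite -[X in _ = X -> _]/(linked _ _ _ [:: _; _; _; _]) adj0.
pose x0 := w 0.
pose x (m : 'I_t) := odflt x0 (blowup a Z i j m).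
pose y (m : 'I_t) := odflt x0 (blowup b Z k l m).
have xyP (m n0 : 'I_t) :=
  @linked_spots _ _ _ _ _ _ _ x0 (cross m n0 (ltn_ord m) (ltn_ord n0)).
have xE (m : 'I_t) : blowup a Z i j m = Some (x m) by have [] := xyP m m.
have yE (m : 'I_t) : blowup b Z k l m = Some (y m) by have [] := xyP m m.
apply: (@clique_or_biclique t x y).
- move=> m n0 e; apply: val_inj.
  by apply: (blowup_inj (ltn_ord m) (ltn_ord n0) lt_i lt_j nZij (xE m)); rewrite e.
- move=> m n0 e; apply: val_inj.
  by apply: (blowup_inj (ltn_ord m) (ltn_ord n0) lt_k lt_l nZkl (yE m)); rewrite e.
- by move=> m n0; have [] := xyP m n0.
- move=> m m' n0 n' lt_m lt_n.
  have := @blowup_homogeneous a Z i j m m' n0 n' lt_i lt_j.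
  rewrite lt_m lt_n !ltn_ord => /(_ isT isT) /=.
  by move: (xE m) (xE m') (xE n0) (xE n'); rewrite /blowup => -> -> -> ->.
- move=> m m' n0 n' lt_m lt_n.
  have := @blowup_homogeneous b Z k l m m' n0 n' lt_k lt_l.
  rewrite lt_m lt_n !ltn_ord => /(_ isT isT) /=.
  by move: (yE m) (yE m') (yE n0) (yE n'); rewrite /blowup => -> -> -> ->.
Qed.


End Web.

(** A bounded interior has all of its vertices named by some [a <= r]. *)
Lemma interior_spot r n W Lam x y v :
  rweb r n W Lam -> x \in W -> y \in W -> x != y ->
  v \in path_interior (Lam [set x; y]) ->
  exists a : 'I_r.+1, spot Lam a x y = Some v.
Proof.
move=> [[_ paths _] short] xW yW xy vI.
have A2 := pair_in_web xW yW xy; have [isp ends] := paths _ A2.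
have ends2 : #|path_ends (Lam [set x; y])| = 2 by rewrite ends cards2 xy.
have lt_r := leq_trans (path_interior_card isp ends2) (short _ A2).
have v_enum : v \in enum (path_interior (Lam [set x; y])) by rewrite mem_enum.
have /onthP[a e] := v_enum.
have lt_a : a < r.+1.
  apply: leq_trans (ltnW lt_r); rewrite cardE -onthTE.
  by rewrite e.
by exists (Ordinal lt_a); rewrite /spot (negPf xy).
Qed.

End Graph.

Theorem theorem1p3 (r s t : nat) (s_gt0 : 0 < s) (t_gt0 : 0 < t) :
  exists Omega : nat, 0 < Omega /\
    forall (G : sgraph) (W : {set G}) (Lam : {set G} -> {set G}),
      rweb r Omega W Lam ->
      (contains_induced G (complete_graph t) \/
       contains_induced G (biclique_graph t t)) \/
      exists S : {set G},
        [/\ S \subset W /\ #|S| = s,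
            stable S,
            forall x y z : G, x \in S -> y \in S -> z \in S ->
              x != y -> y != z -> x != z ->
              anticomplete [set x] (path_interior (Lam [set y; z]))
          & forall A B : {set G},
              A \in subsets_of_size S 2 -> B \in subsets_of_size S 2 -> A != B ->
              anticomplete (path_interior (Lam A)) (path_interior (Lam B))].
Proof.
(* [S] occupies the first [s] of [B] blocks of length [t]; four more blocks
   guarantee that every quadruple of blocks extends to four distinct ones. *)
pose B := s + 4.
have [M Mgood] := order_invariant_subseq ('I_r.+1 * 'I_r.+1)%type 3 (B * t).
exists M.+1; split=> // G W Lam rW; have [webW _] := rW; have [cardW _ _] := webW.
have: 0 < #|W| by rewrite cardW.
case/card_gt0P=> x0 _.
have le_M : M <= size (enum W) by rewrite -cardE cardW.
have [s' [s'W size_s' inv]] :=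
  Mgood G x0 (fun ab p => linked Lam ab.1 ab.2 p) _ le_M.
pose w := nth x0 s'.
have w_in x : x < B * t -> w x \in W.
  by move=> lt_x; rewrite -mem_enum (mem_subseq s'W) // mem_nth // size_s'.
have w_inj x y : x < B * t -> y < B * t -> w x = w y -> x = y.
  move=> lt_x lt_y /eqP; rewrite nth_uniq ?size_s' // => [/eqP//|].
  exact: subseq_uniq s'W (enum_uniq _).
have lt_sB (i : 'I_s) : i < B by rewrite ltn_addr.
have lt_sBt (i : 'I_s) : i * t < B * t by rewrite ltn_pmul2r.
pose S := [set w (i * t) | i : 'I_s].
(* Neither of the pairs [x, y] and [z, u] is contained in the other. *)
pose independent (x y z u : G) := ~~ [&& x \in [:: z; u] & y \in [:: z; u]] &&
  ~~ [&& z \in [:: x; y] & u \in [:: x; y]].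
have SW x : x \in S -> x \in W by case/imsetP=> i _ ->; exact: w_in.
pose bad (a b : 'I_r.+1) (p : 4.-tuple 'I_s) :=
  if val p is [:: i; j; k; l] then
    independent (w (i * t)) (w (j * t)) (w (k * t)) (w (l * t)) &&
    linked Lam a b [:: w (i * t); w (j * t); w (k * t); w (l * t)]
  else false.
case: (boolP [exists a, exists b, exists p, bad a b p]).
  case/existsP=> a /existsP[b] /existsP[p]; rewrite /bad.
  case: (val p) => [|i [|j [|k [|l []]]]] //= /andP[/andP[nij nkl] bad_ijkl].
  have sub (i1 i2 i3 : 'I_s) : val i1 \in [:: val i2; val i3] ->
      w (i1 * t) \in [:: w (i2 * t); w (i3 * t)].
    by rewrite !inE => /orP[]/eqP->; rewrite eqxx ?orbT.
  left; apply: (@adjacency_blows_up _ _ _ _ webW t B w _ _ _ _ r.+1 _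
    a b i j k l) => //; first by rewrite /B addn4.
  - by move=> ? ? ? ? ? ?; apply: (inv (_, _)).
  - by apply: contra nij => /andP[/sub-> /sub->].
  - by apply: contra nkl => /andP[/sub-> /sub->].
move=> no_bad; right; exists S.
have none (a b : 'I_r.+1) x y z u v v' : x \in S -> y \in S -> z \in S -> u \in S ->
    independent x y z u -> spot Lam a x y = Some v -> spot Lam b z u = Some v' ->
    ~~ adj v v'.
  case/imsetP=> [i _ ->] /imsetP[j _ ->] /imsetP[k _ ->] /imsetP[l _ ->] ind ev ev'.
  apply: contra no_bad => vv'.
  apply/existsP; exists a; apply/existsP; exists b.
  by apply/existsP; exists [tuple i; j; k; l]; rewrite /bad /= ind ev ev'.
split.
- split; first by apply/subsetP=> x /SW.
  rewrite card_imset ?card_ord // => i j e.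
  have /eqP := w_inj _ _ (lt_sBt i) (lt_sBt j) e.
  by rewrite eqn_pmul2r // => /eqP/val_inj.
- move=> x y xS yS; have [->|xy] := eqVneq x y; first by rewrite adj_irr.
  apply: (none ord0 ord0 x x y y) => //; rewrite /spot ?eqxx //.
  by rewrite /independent !inE !orbb !andbb (eq_sym y) andbb.
- move=> x y z xS yS zS xy yz xz _ v /set1P-> vI.
  have [b e] := interior_spot rW (SW _ yS) (SW _ zS) yz vI.
  apply: (none ord0 b x x y z) => //; last by rewrite /spot eqxx.
  by rewrite /independent !inE !orbb (eq_sym y) (negPf xy) (negPf xz).
- move=> A1 A2; rewrite !inE => /andP[A1S cA1] /andP[A2S cA2] neqA v v' vI v'I.
  have nsub (A A' : {set G}) : #|A| == 2 -> #|A'| == 2 -> A != A' -> ~~ (A \subset A').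
    move=> /eqP cA /eqP cA'; apply: contraNN => sub.
    by rewrite eqEcard sub cA cA'.
  have ns12 := nsub _ _ cA1 cA2 neqA.
  have ns21 : ~~ (A2 \subset A1) by apply: nsub; rewrite // eq_sym.
  have [x [y [xy A1E]]] := cards2P _ cA1; have [z [u [zu A2E]]] := cards2P _ cA2.
  rewrite A1E A2E in A1S A2S ns12 ns21 vI v'I.
  have [xS yS] : x \in S /\ y \in S by rewrite !(subsetP A1S) ?set21 ?set22.
  have [zS uS] : z \in S /\ u \in S by rewrite !(subsetP A2S) ?set21 ?set22.
  have [a ea] := interior_spot rW (SW _ xS) (SW _ yS) xy vI.
  have [b eb] := interior_spot rW (SW _ zS) (SW _ uS) zu v'I.
  apply: (none a b x y z u) => //.
  by move: ns12 ns21; rewrite !subUset !sub1set /independent !inE => -> ->.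
Qed.
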